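(* Let $A\in\mathbb{R}_{\max}^{d\times d}$ be irreducible, let $\gamma$ be the cyclicity of $\mathcal{G}(A)$, and let $Z$ be an elementary cycle of $\mathcal{G}(A)$ with length $\gamma\left\lfloor\frac{d}{\gamma}\right\rfloor$. Then $$T_{cr}^{\gamma\lfloor d/\gamma\rfloor}(A,Z)\le \gamma\left(\left\lfloor\frac{d}{\gamma}\right\rfloor-1\right)^2+\gamma+d-1.$$
   Context: $\mathbb{R}_{\max}=\mathbb{R}\cup\{-\infty\}$. For $A\in\mathbb{R}_{\max}^{d\times d}$, $\mathcal{G}(A)$ is the digraph with nodes $1,\dots,d$ and an arc $(i,j)$ whenever $a_{ij}\neq-\infty$. The length $l(W)$ of a walk $W$ is its number of arcs. An (elementary) cycle is a closed walk with at least one arc and no repeated node other than its coinciding ends; it is also regarded as a subgraph. $A$ is irreducible if $\mathcal{G}(A)$ is strongly connected. The cyclicity of a strongly connected digraph is the gcd of the lengths of its cycles. Cycle removal threshold: for a subgraph $\mathcal{G}$ of $\mathcal{G}(A)$ and a positive integer $\sigma$, $T_{cr}^{\sigma}(A,\mathcal{G})$ is the smallest nonnegative integer $T$ such that: for all nodes $i,j$ and each walk $W$ on $\mathcal{G}(A)$ from $i$ to $j$ that goes through a node of $\mathcal{G}$ and has length $\ge T$, there is a walk $V$ from $i$ to $j$ going through a node of $\mathcal{G}$, obtained from $W$ by removing cycles and possibly inserting cycles of $\mathcal{G}$, such that $l(V)\equiv l(W)\pmod\sigma$ and $l(V)\le T$. *)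

(* Defs.v *)
From mathcomp Require Import all_boot all_order all_algebra.
From mathcomp Require Import constructive_ereal reals.

Set Implicit Arguments.
Unset Strict Implicit.
Unset Printing Implicit Defensive.

Definition Rmax (R : realType) := {x : \bar R | x != +oo%E}.

Record digraph (T : finType) := Digraph {
  nodes : {set T};
  arc : rel T;
  arc_nodes : forall x y, arc x y -> (x \in nodes) && (y \in nodes) }.

(* A walk from i is coded by the sequence p of its nodes other than i (as in  *)
(* the library's path): its nodes are i :: p and its length is size p.        *)
Definition is_walk (T : finType) (G : digraph T) (i j : T) (p : seq T) : bool :=
  [&& i \in nodes G, path (arc G) i p & last i p == j].

Definition walk_arcs (T : finType) (i : T) (p : seq T) : seq (T * T) :=
  zip (i :: p) p.

Definition goes_through (T : finType) (H : digraph T) (i : T) (p : seq T) : bool :=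
  has (mem (nodes H)) (i :: p).

(* An elementary cycle x_1 -> ... -> x_k -> x_1 is coded by [:: x_1; ...; x_k];*)
(* its length is size c (so [:: x] is a loop).                                *)
Definition elementary_cycle (T : finType) (G : digraph T) (c : seq T) : bool :=
  [&& c != [::], cycle (arc G) c & uniq c].

Definition cycle_arcs (T : finType) (c : seq T) : seq (T * T) :=
  zip c (rot 1 c).

Lemma cycle_arcs_nodes (T : finType) (c : seq T) (x y : T) :
  (x, y) \in cycle_arcs c -> (x \in [set z in c]) && (y \in [set z in c]).
Proof.
move=> xy; rewrite !inE; apply/andP; split.
  by have := map_f fst xy; rewrite -/(unzip1 _) unzip1_zip ?size_rot.
by have := map_f snd xy; rewrite -/(unzip2 _) unzip2_zip ?size_rot // mem_rot.
Qed.

Definition cycle_digraph (T : finType) (c : seq T) : digraph T :=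
  @Digraph T [set z in c] (fun x y => (x, y) \in cycle_arcs c)
    (@cycle_arcs_nodes T c).

Definition subgraph (T : finType) (H G : digraph T) : Prop :=
  nodes H \subset nodes G /\ subrel (arc H) (arc G).

Definition strongly_connected (T : finType) (G : digraph T) : Prop :=
  forall i j, i \in nodes G -> j \in nodes G -> exists p, is_walk G i j p.

(* An elementary cycle has at most #|T| arcs, and 0 is neutral for gcdn.      *)
Definition cyclicity (T : finType) (G : digraph T) : nat :=
  \big[gcdn/0%N]_(l < #|T|.+1 | [exists c : l.-tuple T, elementary_cycle G c]) l.

Lemma matrix_digraph_nodes (R : realType) (d : nat) (A : 'M[Rmax R]_d)
    (i j : 'I_d) :
  sval (A i j) != -oo%E -> (i \in [set: 'I_d]) && (j \in [set: 'I_d]).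
Proof. by rewrite !inE. Qed.

Definition matrix_digraph (R : realType) (d : nat) (A : 'M[Rmax R]_d) :
    digraph 'I_d :=
  @Digraph _ [set: 'I_d] (fun i j => sval (A i j) != -oo%E)
    (@matrix_digraph_nodes R d A).

Definition irreducible_matrix (R : realType) (d : nat) (A : 'M[Rmax R]_d) : Prop :=
  strongly_connected (matrix_digraph A).

(* The walk (i, q) is obtained from the walk (i, p) by removing cycles of G   *)
(* and inserting cycles of H.  Walks are compared through their multisets of  *)
(* arcs: removing the cycles in removed from the arcs of p leaves kept, and   *)
(* inserting the cycles in inserted gives the arcs of q, possibly traversed in*)
(* another order.  Asking removed cycles to be contiguous subwalks would be   *)
(* too strict: in a b c c a b b c a one may remove the cycle a b c and obtain *)
(* a b b c c a.                                                               *)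
Definition remove_insert_cycles (T : finType) (G H : digraph T) (i : T)
    (p q : seq T) : Prop :=
  exists kept : seq (T * T), exists removed inserted : seq (seq T),
    [/\ all (elementary_cycle G) removed,
        all (elementary_cycle H) inserted,
        perm_eq (walk_arcs i p) (kept ++ flatten (map (@cycle_arcs T) removed)) &
        perm_eq (walk_arcs i q) (kept ++ flatten (map (@cycle_arcs T) inserted))].

Definition cycle_removal_bound (R : realType) (d : nat) (A : 'M[Rmax R]_d)
    (H : digraph 'I_d) (sigma T : nat) : Prop :=
  forall (i j : 'I_d) (p : seq 'I_d),
    is_walk (matrix_digraph A) i j p -> goes_through H i p -> T <= size p ->
    exists q : seq 'I_d,
      [/\ is_walk (matrix_digraph A) i j q,
          goes_through H i q,
          remove_insert_cycles (matrix_digraph A) H i p q,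
          size q = size p %[mod sigma] &
          size q <= T].

(* T = T_cr^sigma(A, H), for H a subgraph of G(A) and sigma > 0. *)
Definition is_cycle_removal_threshold (R : realType) (d : nat)
    (A : 'M[Rmax R]_d) (H : digraph 'I_d) (sigma T : nat) : Prop :=
  [/\ 0 < sigma, subgraph H (matrix_digraph A), cycle_removal_bound A H sigma T &
      forall T', cycle_removal_bound A H sigma T' -> T <= T'].

(* Main.v *)
Require Import Defs.
From mathcomp Require Import all_boot all_order all_algebra.
From mathcomp Require Import constructive_ereal reals.
From mathcomp Require Import boolp zify.

(* Write d = #|T|, g = gamma, m = d %/ g. A walk W splits into an elementary  *)
(* path and elementary cycles; the lengths of the latter are multiples of g,  *)
(* and since d < g * m.+1 every cycle meets Z. Keep a short base walk b, the  *)
(* path plus at most one cycle, that meets Z. Among any m other cycles some   *)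
(* have total length divisible by g * m, so all but at most m - 1 of them can *)
(* be removed; the survivors have length at most g * (m - 1). If they all     *)
(* meet b, they are reinserted in b. Otherwise Z is inserted to connect them, *)
(* and its cost is compensated by a survivor c disjoint from b, for which     *)
(* size b + size c < d.                                                       *)

Set Implicit Arguments.
Unset Strict Implicit.
Unset Printing Implicit Defensive.

(** [zero_sum_removal], applied to the cycle lengths divided by g, deletes cycles without changing
    the length modulo g * m. It keeps at most m - 1 of them, each of length at most g * (m - 1).
    [base_walk] supplies a carrier b of length at most d - 1. If all kept cycles meet b,
    [insert_cycles] gives length at most d - 1 + g * (m - 1)^2. If a kept cycle c avoids b, then b
    and c together cost at most d - 1, and with Z the total is at most d - 1 + g * (m - 2) * (m - 1)
    + g * m. This is exactly the bound, as (m - 2) * (m - 1) + m = (m - 1)^2 + 1. [short_walk]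
    assembles both cases. *)

(** * Arcs of walks and of cycles *)

Lemma walk_arcs_cat (T : finType) (i : T) (p q : seq T) :
  walk_arcs i (p ++ q) = walk_arcs i p ++ walk_arcs (last i p) q.
Proof. by elim: p i => //= x p IHp i; rewrite /walk_arcs /= -IHp. Qed.

Lemma size_walk_arcs (T : finType) (i : T) (p : seq T) :
  size (walk_arcs i p) = size p.
Proof. by rewrite size_zip /=; lia. Qed.

Lemma path_walk_arcs (T : finType) (e : rel T) (i : T) (p : seq T) :
  path e i p = all (fun a => e a.1 a.2) (walk_arcs i p).
Proof. by elim: p i => //= x p IHp i; rewrite IHp. Qed.

Lemma cycle_arcs_cons (T : finType) (x : T) (c : seq T) :
  cycle_arcs (x :: c) = walk_arcs x (rcons c x).
Proof.
(* [zip] truncates, so the extra last node is harmless. *)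
have zipE (y z : T) t s :
    zip (t :: s) (rcons s y) = zip (t :: rcons s z) (rcons s y).
  by elim: s t => //= u s IHs t; rewrite -IHs.
by rewrite /cycle_arcs rot1_cons; apply: zipE.
Qed.

Lemma size_cycle_arcs (T : finType) (c : seq T) : size (cycle_arcs c) = size c.
Proof. by rewrite size_zip size_rot minnn. Qed.

Lemma perm_flatten_cycle_arcs (T : finType) (cs cs' : seq (seq T)) :
  perm_eq cs cs' ->
  perm_eq (flatten (map (@cycle_arcs T) cs)) (flatten (map (@cycle_arcs T) cs')).
Proof. by move=> ?; apply/perm_flatten/perm_map. Qed.

Lemma size_flatten_cycle_arcs (T : finType) (cs : seq (seq T)) :
  size (flatten (map (@cycle_arcs T) cs)) = sumn (map size cs).
Proof.
by rewrite size_flatten /shape -map_comp (eq_map (@size_cycle_arcs T)).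
Qed.

Lemma cycle_arcs_rot (T : finType) (n : nat) (c : seq T) :
  perm_eq (cycle_arcs (rot n c)) (cycle_arcs c).
Proof.
rewrite /cycle_arcs rot_rot.
rewrite {1}/rot {1}/rot zip_cat ?size_drop ?size_rot // perm_catC.
rewrite -zip_cat; last by rewrite !size_take size_rot.
by rewrite !cat_take_drop.
Qed.

Lemma elementary_cycle_self (T : finType) (G : digraph T) (c : seq T) :
  elementary_cycle G c -> elementary_cycle (cycle_digraph c) c.
Proof.
case/and3P=> c0 _ uc; apply/and3P; split=> //.
case: c c0 {uc} => // x c _.
by rewrite [cycle _ _]path_walk_arcs -cycle_arcs_cons; apply/allP=> -[].
Qed.

Lemma cycle_digraph_sub (T : finType) (G : digraph T) (c : seq T) :
  elementary_cycle G c -> subgraph (cycle_digraph c) G.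
Proof.
case/and3P=> c0 cyc _; case: c c0 cyc => // x c _.
rewrite [cycle _ _]path_walk_arcs -cycle_arcs_cons => /allP arcs.
have sub : subrel (Defs.arc (cycle_digraph (x :: c))) (Defs.arc G).
  by move=> y z /arcs.
split=> //; apply/subsetP=> y; rewrite inE => yc.
have : cycle (Defs.arc G) (x :: c).
  by rewrite [cycle _ _]path_walk_arcs -cycle_arcs_cons; apply/allP.
by move/next_cycle=> /(_ _ yc) /arc_nodes /andP[].
Qed.

(** * Inserting cycles into walks and extracting them *)

(** Rotate [c] to start at a shared node and make the detour there. The two inclusions ensure that
    any cycle meeting the old walk or [c] can be inserted afterwards. *)
Lemma insert_cycle (T : finType) (G : digraph T) (i : T) (q c : seq T) :
  path (Defs.arc G) i q -> elementary_cycle G c -> has (mem (i :: q)) c ->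
  exists q', [/\ path (Defs.arc G) i q', last i q' = last i q,
    perm_eq (walk_arcs i q') (walk_arcs i q ++ cycle_arcs c),
    {subset i :: q <= i :: q'} & {subset c <= i :: q'}].
Proof.
move=> qG /and3P[_ cycc _] /hasP[x xc] /= xq.
have [n c' cE] := rot_to xc.
case/splitPl: xq qG => q1 q2 q1x; rewrite cat_path q1x => /andP[q1G q2G].
have c'G : path (Defs.arc G) x (rcons c' x).
  by move: cycc; rewrite -(rot_cycle n) cE.
exists (q1 ++ rcons c' x ++ q2); split.
- by rewrite !cat_path q1x last_rcons q1G c'G.
- by rewrite !last_cat last_rcons q1x.
- rewrite !walk_arcs_cat q1x last_rcons -cycle_arcs_cons -cE -catA perm_cat2l.
  by rewrite perm_catC perm_cat2l cycle_arcs_rot.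
- move=> y; rewrite !(inE, mem_cat).
  by case/or3P=> ->; rewrite ?orbT.
- move=> y; rewrite -(mem_rot n) cE !(inE, mem_cat, mem_rcons).
  by case/orP=> ->; rewrite ?orbT.
Qed.

Lemma insert_cycles (T : finType) (G : digraph T) (i : T) (q : seq T)
    (cs : seq (seq T)) :
  path (Defs.arc G) i q -> all (elementary_cycle G) cs ->
  all (has (mem (i :: q))) cs ->
  exists q', [/\ path (Defs.arc G) i q', last i q' = last i q,
    perm_eq (walk_arcs i q')
      (walk_arcs i q ++ flatten (map (@cycle_arcs T) cs)) &
    {subset i :: q <= i :: q'}].
Proof.
elim: cs q => [|c cs IHcs] q qG /=; first by exists q; split; rewrite ?cats0.
case/andP=> cG csG /andP[cq csq].
have [q1 [q1G lq1 pq1 sq1 _]] := insert_cycle qG cG cq.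
have [|q2 [q2G lq2 pq2 sq2]] := IHcs q1 q1G csG.
  by apply: sub_all csq => c'; apply: sub_has => x; apply: sq1.
exists q2; split=> //; first by rewrite lq2.
- by rewrite (permPl pq2) catA perm_cat2r.
- by move=> x /sq1/sq2.
Qed.

(** Loop erasure from the end of the walk: when the prepended node [i] already lies on the path, the
    stretch up to it is an elementary cycle and is cut off. That cycle shares [i] with the remaining
    path, whence the last disjunct, which [base_walk] uses to put a cycle back. *)
Lemma walk_decomposition (T : finType) (G : digraph T) (i : T) (p : seq T) :
  path (Defs.arc G) i p ->
  exists b cs, [/\ path (Defs.arc G) i b, last i b = last i p, uniq (i :: b),
    all (elementary_cycle G) cs &
    perm_eq (walk_arcs i p)
      (walk_arcs i b ++ flatten (map (@cycle_arcs T) cs))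
    /\ (b = p \/ has (has (mem (i :: b))) cs)].
Proof.
elim: p i => [|x p IHp] i /=.
  by exists [::], [::]; split=> //; split=> //; left.
case/andP=> ix /IHp [b [cs [bG lb ub csG [pb bcs]]]].
have pib : perm_eq (walk_arcs i (x :: p))
    (walk_arcs i (x :: b) ++ flatten (map (@cycle_arcs T) cs)).
  by rewrite /= perm_cons.
have [ib|nib] := boolP (i \in x :: b); last first.
  exists (x :: b), cs; rewrite /= ix bG nib; split=> //; split=> //.
  case: bcs => [->|bcs]; [by left|right].
  apply: sub_has bcs => c; apply: sub_has => y /=.
  by rewrite [in X in _ -> X]inE orbC => ->.
have [s1 [s2 sE]] : exists s1 s2, x :: b = s1 ++ i :: s2.
  by case/splitPr: ib => s1 s2; exists s1, s2.
have xbG : path (Defs.arc G) i (x :: b) by rewrite /= ix.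
have ls : last i (x :: b) = last i s2 by rewrite sE last_cat.
move: xbG; rewrite sE -cat_rcons cat_path last_rcons => /andP[s1G s2G].
have us : uniq (s1 ++ i :: s2) by rewrite -sE.
have us1 : uniq (i :: s1).
  by move: us; rewrite -cat_rcons cat_uniq rcons_uniq => /andP[].
exists s2, ((i :: s1) :: cs); split=> //.
- by rewrite -ls /= lb.
- by move: us; rewrite cat_uniq => /and3P[].
- by rewrite /= csG andbT; apply/and3P; split.
split; last by right; rewrite /= inE eqxx.
rewrite (permPl pib) sE -cat_rcons walk_arcs_cat last_rcons -cycle_arcs_cons /=.
by rewrite -catA perm_catCA.
Qed.

(** * Zero-sum selection of cycles *)

(* Pigeonhole on the partial sums modulo m. *)
Lemma zero_sum_block (U : eqType) (w : U -> nat) (m : nat) (s : seq U) :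
  0 < m -> m <= size s ->
  exists2 b, b != [::] /\ m %| sumn (map w b) & exists s', perm_eq s (b ++ s').
Proof.
move=> m0 ms.
pose S k := sumn (map w (take k s)).
pose f (k : 'I_m.+1) : 'I_m := Ordinal (ltn_pmod (S k) m0).
have /injectivePn[k [l kl fkl]] : ~~ injectiveb f.
  by apply/negP=> /injectiveP/leq_card; rewrite !card_ord ltnn.
wlog {kl} kl : k l fkl / k < l.
  move=> H; case: (ltngtP k l) => [|lk|/val_inj klE]; first exact: H.
    by apply: (H l k).
  by rewrite klE eqxx in kl.
have tE : take l s = take k s ++ take (l - k) (drop k s).
  by rewrite take_drop subnK ?(ltnW kl) // -{1}(cat_take_drop k (take l s))
     take_takel // ltnW.
exists (take (l - k) (drop k s)).
  split.
    by rewrite -size_eq0 size_take size_drop; have := ltn_ord l; case: ifP; lia.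
  have : S k = S l %[mod m] by move/(congr1 val): fkl.
  rewrite /S tE map_cat sumn_cat -{1}[sumn _]addn0 => /eqP.
  by rewrite eqn_modDl mod0n eq_sym.
exists (take k s ++ drop l s).
by rewrite -{1}(cat_take_drop l s) tE -catA perm_catCA.
Qed.

(** Blocks of sum 0 modulo [m] are stripped, single elements first, until fewer than [m] elements
    remain. The last clause later excludes kept cycles of length g * m. *)
Lemma zero_sum_removal (U : eqType) (w : U -> nat) (m : nat) (s : seq U) :
  0 < m ->
  exists r k, [/\ perm_eq s (r ++ k), m %| sumn (map w r), size k < m &
    all (fun x => ~~ (m %| w x)) k].
Proof.
move=> m0; have [n] := ubnP (size s); elim: n s => // n IHn s sn.
have step b s' : b != [::] /\ m %| sumn (map w b) -> perm_eq s (b ++ s') ->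
    exists r k, [/\ perm_eq s (r ++ k), m %| sumn (map w r), size k < m &
      all (fun x => ~~ (m %| w x)) k].
  move=> [b0 mb] sE.
  have [|r [k [s'E mr km kall]]] := IHn s'.
    move: (perm_size sE) sn b0; rewrite size_cat -size_eq0; lia.
  exists (b ++ r), k; split=> //; last by rewrite map_cat sumn_cat dvdn_add.
  by rewrite (permPl sE) -catA perm_cat2l.
have [/hasP[x xs mx]|none] := boolP (has (fun x => m %| w x) s).
  by apply: (step [:: x] (rem x s)); rewrite ?perm_to_rem //= addn0.
have [/(zero_sum_block w m0)[b Hb [s' sE]]|sm] := leqP m (size s).
  exact: step sE.
by exists [::], s; rewrite -all_predC in none *; split.
Qed.

(** * Cycle lengths and the base walk *)

Lemma disjoint_size_leq (T : finType) (s t : seq T) :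
  uniq s -> uniq t -> ~~ has (mem s) t -> size s + size t <= #|T|.
Proof.
move=> us ut st; rewrite -size_cat -(card_uniqP _) ?max_card //.
by rewrite cat_uniq us st.
Qed.

Lemma uniq_size_max (T : finType) (c : seq T) : uniq c -> size c <= #|T|.
Proof. by move/card_uniqP <-; apply: max_card. Qed.

Lemma cyclicity_dvd (T : finType) (G : digraph T) (c : seq T) :
  elementary_cycle G c -> cyclicity G %| size c.
Proof.
move=> cG; have /and3P[_ _ uc] := cG.
have cT : size c < #|T|.+1 by rewrite ltnS -(card_uniqP uc) max_card.
apply: (biggcdn_inf (Ordinal cT)) => //=.
by apply/existsP; exists (in_tuple c).
Qed.

(* If the path left by the decomposition avoids Z, it has at most #|T| - g * m*)
(* nodes, while a cycle, or two disjoint cycles, have at most g * m nodes     *)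
(* altogether: one removed cycle that meets the path can be put back.         *)
Lemma base_walk (T : finType) (G : digraph T) (g m : nat) (Z : seq T)
    (i : T) (p : seq T)
    (gG : forall c, elementary_cycle G c -> g %| size c)
    (ZG : elementary_cycle G Z) (sizeZ : size Z = g * m)
    (meetZ : forall c, elementary_cycle G c -> has (mem Z) c)
    (card_lt : #|T| < g * m.+1) :
  path (Defs.arc G) i p -> has (mem Z) (i :: p) ->
  exists b cs, [/\ path (Defs.arc G) i b /\ last i b = last i p,
    has (mem Z) (i :: b), all (elementary_cycle G) cs,
    perm_eq (walk_arcs i p)
      (walk_arcs i b ++ flatten (map (@cycle_arcs T) cs)) &
    size b < #|T| /\ forall c, elementary_cycle G c ->
      ~~ has (mem (i :: b)) c -> size b + size c < #|T|].
Proof.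
move=> pG pZ; have [b [cs [bG lb ub csG [pb bcs]]]] := walk_decomposition pG.
have sb : size b < #|T|.
  by have := max_card (mem (i :: b)); rewrite (card_uniqP ub).
have [bZ|bZ] := boolP (has (mem Z) (i :: b)).
  exists b, cs; split=> //; split=> // c /and3P[_ _ uc] bc.
  exact: (disjoint_size_leq ub uc bc).
(* Here [b] differs from [p], since only [p] meets [Z]. *)
case: bcs => [bp|/hasP[c0 c0cs bc0]]; first by rewrite bp pZ in bZ.
have c0G : elementary_cycle G c0 by apply: (allP csG).
have [q [qG lq pq sbq sc0q]] := insert_cycle bG c0G bc0.
have sq : size q = size b + size c0.
  by have := perm_size pq; rewrite size_cat !size_walk_arcs size_cycle_arcs.
have /and3P[c0n _ uc0] := c0G; have /and3P[_ _ uZ] := ZG.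
have := disjoint_size_leq uZ ub bZ; rewrite sizeZ /= => bZsize.
have mult k : g %| k -> k <= #|T| -> k <= g * m.
  move=> /dvdnP[u ->] uT; rewrite mulnC leq_mul2l; apply/orP; right.
  by have := leq_ltn_trans uT card_lt; rewrite mulnC ltn_mul2l ltnS => /andP[].
exists q, (rem c0 cs); split.
- by rewrite lq.
- have /hasP[x xc xZ] := meetZ _ c0G; apply/(@hasP _ _ (i :: q)).
  by exists x => //; apply: sc0q.
- by apply/allP=> c /mem_rem/(allP csG).
- rewrite (permPl pb) (permPr (perm_cat pq (perm_refl _))) -catA perm_cat2l.
  exact: perm_flatten_cycle_arcs (perm_to_rem c0cs).
split=> [|c cG qc].
  rewrite sq; apply: leq_trans bZsize.
  by rewrite addnS ltnS addnC leq_add2r; apply: mult (gG _ c0G) (uniq_size_max uc0).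
have /and3P[_ _ uc] := cG.
have c0c : ~~ has (mem c0) c.
  by apply: contra qc; apply: sub_has => x /sc0q.
rewrite sq -addnA; apply: leq_trans bZsize.
rewrite addnS ltnS addnC leq_add2r.
exact: mult (dvdn_add (gG _ c0G) (gG _ cG)) (disjoint_size_leq uc0 uc c0c).
Qed.

(** * The length estimate and the threshold *)

Lemma short_walk (T : finType) (G : digraph T) (g m : nat) (Z : seq T)
    (i : T) (p : seq T)
    (gG : forall c, elementary_cycle G c -> g %| size c)
    (ZG : elementary_cycle G Z) (sizeZ : size Z = g * m)
    (card_lt : #|T| < g * m.+1) :
  path (Defs.arc G) i p -> has (mem Z) (i :: p) ->
  exists q, [/\ path (Defs.arc G) i q /\ last i q = last i p, has (mem Z) (i :: q),
    remove_insert_cycles G (cycle_digraph Z) i p q,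
    size q = size p %[mod g * m] &
    size q <= g * (m - 1) ^ 2 + g + #|T| - 1].
Proof.
move=> pG pZ.
have gm0 : 0 < g * m by rewrite -sizeZ lt0n size_eq0; case/and3P: ZG.
have [g0 m0] : 0 < g /\ 0 < m by apply/andP; rewrite -muln_gt0.
(* A cycle disjoint from [Z] has at least [g] further nodes, too many for [T]. *)
have meetZ c : elementary_cycle G c -> has (mem Z) c.
  move=> cG; have /and3P[cn _ uc] := cG; have /and3P[_ _ uZ] := ZG.
  apply/negPn/negP=> /(disjoint_size_leq uZ uc).
  rewrite -size_eq0 -lt0n in cn; apply/negP; rewrite -ltnNge.
  apply: leq_trans card_lt _.
  by rewrite sizeZ mulnSr leq_add2l dvdn_leq ?gG.
have [b [cs [[bG lb] bZ csG pb [sb disj]]]] :=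
  base_walk gG ZG sizeZ meetZ card_lt pG pZ.
have [r [k [csE mr km kall]]] := zero_sum_removal (fun c => size c %/ g) cs m0.
have rkG : all (elementary_cycle G) (r ++ k) by rewrite -(perm_all _ csE).
have [rG kG] : all (elementary_cycle G) r /\ all (elementary_cycle G) k.
  by apply/andP; rewrite -all_cat.
have gmr : g * m %| sumn (map size r).
  have -> : sumn (map size r) = g * sumn (map (fun c => size c %/ g) r).
    elim: r rG {mr csE rkG} => [|c r IHr] /=; first by rewrite muln0.
    by case/andP=> cG /IHr ->; rewrite mulnDr [g * (_ %/ _)]mulnC divnK ?gG.
  by rewrite dvdn_pmul2l.
have predm u : u < m -> u <= m - 1 by move=> um; rewrite subn1 -ltnS prednK.
(* The length is u * g with u <= m, and u = m is excluded by [kall]. *)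
have ksize c : c \in k -> size c <= g * (m - 1).
  move=> ck; have cG := allP kG _ ck; have /and3P[_ _ uc] := cG.
  have := allP kall _ ck; have /dvdnP[u cE] := gG _ cG.
  rewrite /= cE mulnK // mulnC leq_mul2l.
  have : u < m.+1.
    rewrite -(ltn_pmul2r g0) -cE mulnC; apply: leq_ltn_trans card_lt.
    exact: uniq_size_max.
  rewrite ltnS leq_eqVlt => /orP[/eqP->|um _]; first by rewrite dvdnn.
  by rewrite predm ?orbT.
have ksum s : {subset s <= k} -> sumn (map size s) <= size s * (g * (m - 1)).
  elim: s => //= c s IHs sk; rewrite mulSn leq_add ?ksize ?sk ?mem_head //.
  by apply: IHs => x xs; rewrite sk // inE xs orbT.
have pE : perm_eq (walk_arcs i p) ((walk_arcs i b ++
    flatten (map (@cycle_arcs T) k)) ++ flatten (map (@cycle_arcs T) r)).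
  rewrite (permPl pb) -catA perm_cat2l perm_sym perm_catC -flatten_cat.
  rewrite -map_cat perm_sym.
  exact: perm_flatten_cycle_arcs.
have sp : size p = size b + sumn (map size k) + sumn (map size r).
  by have := perm_size pE; rewrite !size_cat !size_walk_arcs
     !size_flatten_cycle_arcs.
have [bk|] := boolP (all (has (mem (i :: b))) k).
  have [q [qG lq pq sbq]] := insert_cycles bG kG bk.
  have sq : size q = size b + sumn (map size k).
    by have := perm_size pq; rewrite !size_cat !size_walk_arcs
       size_flatten_cycle_arcs.
  exists q; split.
  - by rewrite lq.
  - by have /hasP[x /sbq xq xZ] := bZ; apply/(@hasP _ _ (i :: q)); exists x.
  - exists (walk_arcs i b ++ flatten (map (@cycle_arcs T) k)), r, [::].
    by rewrite /= !cats0.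
  - by rewrite sp sq -[in RHS]modnDmr (eqP gmr) addn0.
  - have := ksum k (fun _ => id); rewrite sq.
    have : size k * (g * (m - 1)) <= (m - 1) * (g * (m - 1)).
      by rewrite leq_mul2r predm ?orbT.
    by rewrite [(m - 1) * (g * _)]mulnCA mulnn; move: sb g0; clear; lia.
rewrite -has_predC => /hasP[c ck /= bc].
have cG := allP kG _ ck.
(* [Z] meets [b] and every cycle, so inserting it makes all of [k] attachable; its length is 0
   modulo g * m. *)
have [q1 [q1G lq1 pq1 sbq1 sZq1]] : exists q', [/\ path (Defs.arc G) i q',
    last i q' = last i b,
    perm_eq (walk_arcs i q') (walk_arcs i b ++ cycle_arcs Z),
    {subset i :: b <= i :: q'} & {subset Z <= i :: q'}].
  by apply: insert_cycle; rewrite // has_sym.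
have kq1 : all (has (mem (i :: q1))) k.
  apply/allP=> c' /(allP kG)/meetZ; apply: sub_has => x; exact: sZq1.
have [q [qG lq pq sq1q]] := insert_cycles q1G kG kq1.
have qE : perm_eq (walk_arcs i q) ((walk_arcs i b ++
    flatten (map (@cycle_arcs T) k)) ++ flatten (map (@cycle_arcs T) [:: Z])).
  rewrite /= cats0 (permPl pq) (permPl (perm_cat pq1 (perm_refl _))).
  by rewrite -!catA perm_cat2l perm_catC.
have sq : size q = size b + sumn (map size k) + g * m.
  by have := perm_size qE; rewrite !size_cat !size_walk_arcs
     size_flatten_cycle_arcs size_cycle_arcs addn0 sizeZ.
exists q; split.
- by rewrite lq lq1.
- by have /hasP[x /sbq1/sq1q xq xZ] := bZ; apply/(@hasP _ _ (i :: q)); exists x.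
- exists (walk_arcs i b ++ flatten (map (@cycle_arcs T) k)), r, [:: Z].
  by rewrite /= (elementary_cycle_self ZG) in qE *.
- by rewrite sp sq -[in RHS]modnDmr (eqP gmr) addn0 modnDr.
have /permP/(_ predT) := perm_to_rem ck.
rewrite !count_predT /= => sk.
have := perm_sumn (perm_map size (perm_to_rem ck)) => /= sumk.
(* The kept cycle [c] gives 0 < size k < m, so the truncated m - 2 is a true difference. *)
have [u mE] : exists u, m = u.+2.
  exists (m - 2); move: km; rewrite sk; move: (size _) => n; clear; lia.
have : sumn (map size (rem c k)) <= (m - 2) * (g * (m - 1)).
  apply: leq_trans (ksum _ (@mem_rem _ _ _)) _.
  by rewrite leq_mul2r; apply/orP; right; move: km; rewrite sk mE subn2.
have := disj _ cG bc; rewrite sq sumk mE subn2 subn1 /=.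
move: (sumn _) (size c) (size b) #|T| => sr sc sb' t; clear; nia.
Qed.

Theorem proposition4p8 (R : realType) (d : nat) (A : 'M[Rmax R]_d)
    (gamma : nat) (Z : seq 'I_d)
    (irrA : irreducible_matrix A)
    (gammaE : gamma = cyclicity (matrix_digraph A))
    (cycZ : elementary_cycle (matrix_digraph A) Z)
    (sizeZ : size Z = gamma * (d %/ gamma)) :
  exists2 T : nat,
    is_cycle_removal_threshold A (cycle_digraph Z) (gamma * (d %/ gamma)) T &
    T <= gamma * (d %/ gamma - 1) ^ 2 + gamma + d - 1.
Proof.
have gm0 : 0 < gamma * (d %/ gamma).
  by rewrite -sizeZ lt0n size_eq0; case/and3P: cycZ.
have g0 : 0 < gamma by move: gm0; rewrite muln_gt0 => /andP[].
have through i (p : seq 'I_d) :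
    goes_through (cycle_digraph Z) i p = has (mem Z) (i :: p).
  by apply: eq_has => x; rewrite /= inE.
(* Classical reflection to a boolean predicate, so that [ex_minnP] yields the least bound. *)
pose bounds T := `[< cycle_removal_bound A (cycle_digraph Z)
  (gamma * (d %/ gamma)) T >].
have bound : bounds (gamma * (d %/ gamma - 1) ^ 2 + gamma + d - 1).
  apply/asboolP=> i j p /and3P[_ pG /eqP lp]; rewrite through => pZ _.
  have card_lt : #|'I_d| < gamma * (d %/ gamma).+1.
    by rewrite card_ord mulnC ltn_ceil.
  have gG c : elementary_cycle (matrix_digraph A) c -> gamma %| size c.
    by rewrite gammaE; apply: cyclicity_dvd.
  have [q [[qG lq] qZ pq modq sq]] := short_walk gG cycZ sizeZ card_lt pG pZ.
  exists q; split=> //; last by rewrite card_ord in sq.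
    by rewrite /is_walk inE qG lq lp eqxx.
  by rewrite through.
have exB : exists T, bounds T by eexists; apply: bound.
case: (ex_minnP exB) => T /asboolP TB Tmin.
exists T; last exact: Tmin.
split=> //; first exact: cycle_digraph_sub cycZ.
by move=> T' /asboolP; apply: Tmin.
Qed.
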